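(* Let $n\ge 1$ and let $\lambda=(\lambda_1,\dots,\lambda_n)$ be a partition with at most $n$ parts (padded with zeros). Then \[ G_\lambda(x_1,\dots,x_n;\boldsymbol\alpha,\boldsymbol\beta)=\det\Big(h_{\lambda_i-i+j}\big[X_n\ominus(A_{\lambda_i}-B_{i-1})\big]\Big)_{i,j=1}^n \] and \[ g_\lambda(x_1,\dots,x_n;\boldsymbol\alpha,\boldsymbol\beta)=\det\Big(h_{\lambda_i-i+j}\big[X_n-A_{\lambda_i-1}+B_{i-1}\big]\Big)_{i,j=1}^n . \]
   Context: Let $x_1,x_2,\dots$ be variables and $\boldsymbol\alpha=(\alpha_1,\alpha_2,\dots)$, $\boldsymbol\beta=(\beta_1,\beta_2,\dots)$ parameters. Put $A_k=\alpha_1+\dots+\alpha_k$, $B_k=\beta_1+\dots+\beta_k$ for $k\ge1$ and $A_k=B_k=0$ for $k\le 0$; $X_n=x_1+\dots+x_n$. Plethystic notation: for a formal $\mathbb Z$-linear combination $Z=\sum_u c_u u$ of variables/parameters, define $h_m[Z]$ and $e_m[Z]$ by $\sum_{m\ge0}h_m[Z]t^m=\prod_u(1-ut)^{-c_u}$ and $\sum_{m\ge0}e_m[Z]t^m=\prod_u(1+ut)^{c_u}$, with $h_m[Z]=e_m[Z]=0$ for $m<0$. For two such combinations $Y,W$ and any integer $m$, set $h_m[Y\ominus W]=\sum_{a,b\ge0,\,a-b=m}h_a[Y]h_b[W]$ and $e_m[Y\ominus W]=\sum_{a,b\ge0,\,a-b=m}e_a[Y]e_b[W]$ (possibly nonzero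 for $m<0$). For a partition $\lambda$ with at most $n$ parts, the refined canonical stable Grothendieck polynomial is the formal power series \[ G_\lambda(x_1,\dots,x_n;\boldsymbol\alpha,\boldsymbol\beta)=\frac{\det\Big(x_j^{\lambda_i+n-i}\frac{\prod_{k=1}^{i-1}(1-\beta_kx_j)}{\prod_{k=1}^{\lambda_i}(1-\alpha_kx_j)}\Big)_{i,j=1}^n}{\prod_{1\le i<j\le n}(x_i-x_j)}, \] and its dual is \[ g_\lambda(x_1,\dots,x_n;\boldsymbol\alpha,\boldsymbol\beta)=\frac{\det\big(h_{\lambda_i+n-i}[x_j-A_{\lambda_i-1}+B_{i-1}]\big)_{i,j=1}^n}{\prod_{1\le i<j\le n}(x_i-x_j)}. \] *)

(* Defs.v *)
From HB Require Import structures.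
From mathcomp Require Import all_boot all_order all_algebra.
From mathcomp Require Import finmap.
From mathcomp Require Import boolp classical_sets functions cardinality fsbigop.
From mathcomp Require Import monalg.

Set Implicit Arguments.
Unset Strict Implicit.
Unset Printing Implicit Defensive.

Import GRing.Theory.

Local Open Scope classical_set_scope.
Local Open Scope ring_scope.

Local Notation "1" := (@mone _) : monom_scope.
Local Notation "a * b" := (mmul a b) : monom_scope.

(* Multivariate formal power series over R in the (possibly infinitely many)
   variables V: arbitrary families of coefficients indexed by the monomials
   {cmonom V}. A record is used so that the pointwise ring structure that
   [functions] puts on arrow types is not inferred. *)
Record mfps (R : Type) (V : choiceType) : Type :=
  MFPS { mfps_coef : {cmonom V} -> R }.

Coercion mfps_coef : mfps >-> Funclass.

HB.instance Definition _ (R : Type) (V : choiceType) := gen_eqMixin (mfps R V).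
HB.instance Definition _ (R : Type) (V : choiceType) :=
  gen_choiceMixin (mfps R V).

Lemma mfpsP (R : Type) (V : choiceType) (f g : mfps R V) :
  (forall m, f m = g m) -> f = g.
Proof. by case: f g => [f] [g] /= fg; congr MFPS; apply/funext. Qed.

Lemma cmonom_divisors (V : choiceType) (m : {cmonom V}) :
  exists2 D : seq {cmonom V}, uniq D & forall a b, (a * b)%M = m -> a \in D.
Proof.
pose mon (g : {ffun finsupp m -> 'I_(mdeg m).+1}) : {cmonom V} :=
  mkcmonom [fsfun i in finsupp m => if insub i is Some j then g j : nat else 0%N | 0%N].
exists (undup [seq mon g | g : {ffun finsupp m -> 'I_(mdeg m).+1}]).
  exact: undup_uniq.
move=> a b abm; rewrite mem_undup; apply/mapP.
exists [ffun j => inord (a (val j))]; first by rewrite mem_enum.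
apply/eqP/cmP => i; rewrite /mon cmE fsfun_fun.
have lem : (a i <= m i)%N by rewrite -abm cmM leq_addr.
have [im|] := boolP (i \in finsupp m).
  rewrite insubT /= ffunE inordK //= ltnS (leq_trans lem) //.
  by rewrite mdegE (big_fsetD1 i) //= leq_addr.
by rewrite -cmE_eq0 => /eqP m0; move: lem; rewrite m0 leqn0 => /eqP.
Qed.

Lemma sum_seq_pred1 (R : nmodType) (T : eqType) (r : seq T) (x : T)
  (F : T -> R) : uniq r -> x \in r -> \sum_(i <- r | i == x) F i = F x.
Proof.
move=> ru xr; rewrite big_mkcond (bigD1_seq x) //= eqxx big1 ?addr0 //.
by move=> i /negPf ->.
Qed.

Section MfpsZmod.
Variables (R : zmodType) (V : choiceType).
Implicit Types f g : mfps R V.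

Definition mfps_zero : mfps R V := MFPS (fun=> 0).
Definition mfps_opp f : mfps R V := MFPS (fun m => - f m).
Definition mfps_add f g : mfps R V := MFPS (fun m => f m + g m).

Lemma mfps_addA : associative mfps_add.
Proof. by move=> f g h; apply: mfpsP => m /=; rewrite addrA. Qed.
Lemma mfps_addC : commutative mfps_add.
Proof. by move=> f g; apply: mfpsP => m /=; rewrite addrC. Qed.
Lemma mfps_add0 : left_id mfps_zero mfps_add.
Proof. by move=> f; apply: mfpsP => m /=; rewrite add0r. Qed.
Lemma mfps_addN : left_inverse mfps_zero mfps_opp mfps_add.
Proof. by move=> f; apply: mfpsP => m /=; rewrite addNr. Qed.

HB.instance Definition _ := GRing.isZmodule.Build (mfps R V)
  mfps_addA mfps_addC mfps_add0 mfps_addN.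
End MfpsZmod.

Section MfpsRing.
Variables (R : comNzRingType) (V : choiceType).
Implicit Types f g : mfps R V.

(* c times the monomial m *)
Definition mfps_term (c : R) (m : {cmonom V}) : mfps R V :=
  MFPS (fun m' => if m' == m then c else 0).

Definition mfps_one : mfps R V := mfps_term 1 1%M.

Definition mfps_mul f g : mfps R V :=
  MFPS (fun m => \sum_(p \in [set p | (p.1 * p.2)%M = m]) f p.1 * g p.2).

Lemma mfps_mulE (D : seq {cmonom V}) f g (m : {cmonom V}) : uniq D ->
  (forall a b, (a * b)%M = m -> a \in D) ->
  mfps_mul f g m = \sum_(a <- D) \sum_(b <- D | (a * b)%M == m) f a * g b.
Proof.
move=> Du Dm /=.
pose r := [seq p <- [seq (a, b) | a <- D, b <- D] | (p.1 * p.2)%M == m].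
have -> : [set p | (p.1 * p.2)%M = m] = [set` r].
  apply/seteqP; split => -[a b] /=.
    move=> abm; rewrite mem_filter /= abm eqxx /=; apply/allpairsP.
    exists (a, b); split=> //=; first exact: Dm abm.
    by apply: (Dm b a); rewrite monalg.mulmC.
  by rewrite mem_filter /= => /andP[/eqP].
rewrite -fsbig_seq; last by rewrite filter_uniq // allpairs_uniq // => -[? ?] [].
rewrite big_filter big_mkcond big_allpairs /=.
by apply: eq_bigr => a _; rewrite [RHS]big_mkcond.
Qed.

Lemma mfps_mulC : commutative mfps_mul.
Proof.
move=> f g; apply: mfpsP => m; have [D Du Dm] := cmonom_divisors m.
rewrite !(mfps_mulE _ _ Du Dm) (exchange_big_dep predT) //=.
apply: eq_bigr => a _; apply: eq_big => [b|b _]; first by rewrite monalg.mulmC.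
exact: mulrC.
Qed.

Lemma mfps_mul3E (D : seq {cmonom V}) f g h (m : {cmonom V}) : uniq D ->
  (forall a b, (a * b)%M = m -> a \in D) ->
  mfps_mul f (mfps_mul g h) m =
  \sum_(a <- D) \sum_(b <- D) \sum_(c <- D | (a * (b * c))%M == m)
    f a * (g b * h c).
Proof.
move=> Du Dm; rewrite (mfps_mulE _ _ Du Dm); apply: eq_bigr => a _.
transitivity (\sum_(d <- D | (a * d)%M == m)
    \sum_(b <- D) \sum_(c <- D | (b * c)%M == d) f a * (g b * h c)).
  apply: eq_bigr => d /eqP adm; rewrite (@mfps_mulE D) //; last first.
    move=> b c bcd; apply: (Dm b (a * c)%M).
    by rewrite -adm -bcd !monalg.mulmA (monalg.mulmC b a).
  by rewrite mulr_sumr; apply: eq_bigr => b _; rewrite mulr_sumr.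
rewrite exchange_big /=; apply: eq_bigr => b _.
rewrite (exchange_big_dep predT) //= [RHS]big_mkcond /=.
apply: eq_bigr => c _; rewrite big_mkcondl.
have [abc|abc] := ifPn; last first.
  rewrite big1 // => d; case: ifPn => // adm /eqP bcd.
  by rewrite bcd adm in abc.
have bcD : (b * c)%M \in D.
  by apply: (Dm _ a); rewrite monalg.mulmC; apply/eqP.
rewrite (eq_bigl (pred1 (b * c)%M)) => [|d]; last by rewrite /= eq_sym.
by rewrite sum_seq_pred1 //= abc.
Qed.

Lemma mfps_mulA : associative mfps_mul.
Proof.
move=> f g h; apply: mfpsP => m; have [D Du Dm] := cmonom_divisors m.
rewrite [in RHS]mfps_mulC !(mfps_mul3E _ _ _ Du Dm).
rewrite [RHS]exchange_big; apply: eq_bigr => a _.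
rewrite [RHS](exchange_big_dep predT) //=.
apply: eq_bigr => b _; apply: eq_big => [c|c _].
  by rewrite (monalg.mulmC c) monalg.mulmA.
by rewrite (mulrC (h c)) mulrA.
Qed.

Lemma mfps_mul1 : left_id mfps_one mfps_mul.
Proof.
move=> f; apply: mfpsP => m; have [D Du Dm] := cmonom_divisors m.
rewrite (mfps_mulE _ _ Du Dm) (bigD1_seq 1%M) //=; last first.
  by apply: (Dm _ m); rewrite monalg.mul1m.
rewrite [X in _ + X]big1 ?addr0 => [|a /negPf a1]; last first.
  by rewrite big1 // => b _; rewrite a1 mul0r.
rewrite (eq_bigl (pred1 m)) => [|b]; last by rewrite monalg.mul1m.
rewrite sum_seq_pred1 // ?eqxx ?mul1r //.
by apply: (Dm _ 1%M); rewrite monalg.mulm1.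
Qed.

Lemma mfps_mulDl : left_distributive mfps_mul (@mfps_add R V).
Proof.
move=> f g h; apply: mfpsP => m; have [D Du Dm] := cmonom_divisors m.
rewrite (mfps_mulE _ _ Du Dm) [RHS]/=.
rewrite -[X in X + _]/(mfps_mul f h m) -[X in _ + X]/(mfps_mul g h m).
rewrite !(mfps_mulE _ _ Du Dm) -big_split; apply: eq_bigr => a _ /=.
by rewrite -big_split; apply: eq_bigr => b _ /=; rewrite mulrDl.
Qed.

Lemma mfps_oner_neq0 : mfps_one != 0 :> mfps R V.
Proof.
apply/eqP => /(congr1 (fun f : mfps R V => f 1%M)) /=.
by rewrite eqxx; apply/eqP/oner_neq0.
Qed.

HB.instance Definition _ := GRing.Zmodule_isComNzRing.Build (mfps R V)
  mfps_mulA mfps_mulC mfps_mul1 mfps_mulDl mfps_oner_neq0.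

Definition mfps_unit : pred (mfps R V) := fun f => `[< exists g, g * f = 1 >].

Definition mfps_inv f : mfps R V :=
  if pselect (exists g, g * f = 1) is left fP then projT1 (cid fP) else f.

Lemma mfps_mulV : {in mfps_unit, left_inverse 1 mfps_inv *%R}.
Proof.
move=> f /asboolP fP; rewrite /mfps_inv; case: pselect => // fP'.
by case: (cid fP').
Qed.

Lemma mfps_unitP f g : g * f = 1 -> mfps_unit f.
Proof. by move=> gf; apply/asboolP; exists g. Qed.

Lemma mfps_inv_out : {in [predC mfps_unit], mfps_inv =1 id}.
Proof.
by move=> f /asboolPn fP; rewrite /mfps_inv; case: pselect.
Qed.

HB.instance Definition _ := GRing.ComNzRing_hasMulInverse.Build (mfps R V)
  mfps_mulV mfps_unitP mfps_inv_out.

Definition mfps_var (v : V) : mfps R V := mfps_term 1 (ucm v).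

(* The quotient a / b, for b a non zero divisor (a Vandermonde product below;
   it is not a unit, so that the division of the unit ring does not apply). *)
Definition exact_div (a b : mfps R V) : mfps R V := xget 0 [set q | q * b = a].

End MfpsRing.

(* The variables x_i, alpha_k, beta_k are indexed from 1; index 0 is unused. *)
Definition var : choiceType := (nat + nat + nat)%type.
Definition xv (i : nat) : var := inl (inl i).
Definition av (k : nat) : var := inl (inr k).
Definition bv (k : nat) : var := inr k.

Definition series := mfps int var.
Definition x_ (i : nat) : series := mfps_var int (xv i).
Definition alpha (k : nat) : series := mfps_var int (av k).
Definition beta (k : nat) : series := mfps_var int (bv k).

(* Plethystic alphabets: the coefficient of << u >> in Z is Z@_u. *)
Definition alphabet := {malg int[var]}.

Definition alphX (n : nat) : alphabet := \sum_(1 <= i < n.+1) << xv i >>.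
Definition alphA (k : int) : alphabet :=
  if k is Posz k' then \sum_(1 <= i < k'.+1) << av i >> else 0.
Definition alphB (k : int) : alphabet :=
  if k is Posz k' then \sum_(1 <= i < k'.+1) << bv i >> else 0.

(* \prod_u (1 - u t)^(- c_u), as a power series in one variable t over the
   ring of series; the exponent is an integer. *)
Definition pleth_hgen (Z : alphabet) : mfps series unit :=
  \prod_(u <- msupp Z)
    (1 - mfps_term (mfps_var int u) (ucm tt)) ^ (- Z@_u).

Definition pleth_h (m : int) (Z : alphabet) : series :=
  if m is Posz k then pleth_hgen Z (expcmn (ucm tt) k) else 0.

(* The sum over all a, b >= 0 with a - b = m is taken coefficientwise: since
   h_a[Y] h_b[W] is homogeneous of degree a + b, each monomial occurs in at
   most one term, so the finitely supported sum never takes its default. *)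
Definition pleth_h_ominus (m : int) (Y W : alphabet) : series :=
  MFPS (fun mu => \sum_(p \in [set p : nat * nat | p.1%:Z - p.2%:Z = m])
                    (pleth_h p.1 Y * pleth_h p.2 W) mu).

(* Determinants with rows and columns indexed from 1 to n. *)
Definition det_from1 (n : nat) (M : nat -> nat -> series) : series :=
  \det (\matrix_(i < n, j < n) M i.+1 j.+1).

Definition vandermonde (n : nat) : series :=
  \prod_(1 <= i < n.+1) \prod_(i.+1 <= j < n.+1) (x_ i - x_ j).

(* A partition is a weakly decreasing sequence; its parts are indexed from 1
   and padded with zeros. *)
Definition part (lam : seq nat) (i : nat) : nat := nth 0%N lam i.-1.

Definition grothG (n : nat) (lam : seq nat) : series :=
  exact_div
    (det_from1 n (fun i j =>
       x_ j ^+ (part lam i + n - i)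
       * (\prod_(1 <= k < i) (1 - beta k * x_ j))
       / (\prod_(1 <= k < (part lam i).+1) (1 - alpha k * x_ j))))
    (vandermonde n).

Definition grothg (n : nat) (lam : seq nat) : series :=
  exact_div
    (det_from1 n (fun i j =>
       pleth_h ((part lam i)%:Z + n%:Z - i%:Z)
         (<< xv j >> - alphA ((part lam i)%:Z - 1) + alphB (i%:Z - 1))))
    (vandermonde n).

(* Main.v *)
(* Since h_l[x_j - X_n] = (-1)^l e_l[X_n - x_j] vanishes for l >= n, the
   multiplicativity of the generating series of the h_l reads, for p >= 0,
   sum_(l < n) h_l[x_j - X_n] h_(p-l)[Y] = h_p[Y - X_n + x_j].
   Applied to the rows of the Jacobi-Trudi matrix, it says that this matrix times
   E = (h_(n-k)[x_j - X_n])_(k,j) is the numerator matrix.  Applied to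
   h_(k-i)[X_n], whose matrix is unitriangular, it gives
   det E = det (x_j^(n-i)), the Vandermonde product, which is a nonzero
   divisor.  For G, h_m[X_n (-) W] = sum_b h_(m+b)[X_n] h_b[W] is an infinite
   sum, so that the convolution is computed modulo monomials of degree >= N
   and produces x_j^m times the value at t = x_j of sum_b h_b[W] t^b. *)
Require Import Defs.
From HB Require Import structures.
From mathcomp Require Import all_boot all_order all_algebra.
From mathcomp Require Import finmap.
From mathcomp Require Import classical_sets fsbigop.
From mathcomp Require Import monalg.
From mathcomp Require Import perm zify.

Set Implicit Arguments.
Unset Strict Implicit.
Unset Printing Implicit Defensive.

Import Order.TTheory GRing.Theory Num.Theory.

Local Open Scope ring_scope.

(** * Multivariate power series *)

Section PowerSeries.
Variables (R : comNzRingType) (V : choiceType).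
Implicit Types (f g : mfps R V) (m : {cmonom V}).

Lemma mfps_coefD f g m : (f + g) m = f m + g m. Proof. by []. Qed.

Lemma mfps_coef0 m : (0 : mfps R V) m = 0. Proof. by []. Qed.

Lemma mfps_coefN f m : (- f) m = - f m. Proof. by []. Qed.

Lemma mfps_coef_sum (I : Type) (r : seq I) (P : pred I) (F : I -> mfps R V) m :
  (\sum_(i <- r | P i) F i) m = \sum_(i <- r | P i) F i m.
Proof. by apply: (big_morph (fun f : mfps R V => f m)). Qed.

Lemma mfps_coefM (D : seq {cmonom V}) f g m : uniq D ->
  (forall a b, mmul a b = m -> a \in D) ->
  (f * g) m = \sum_(a <- D) \sum_(b <- D | mmul a b == m) f a * g b.
Proof. exact: mfps_mulE. Qed.

Lemma mfps_coef1 m : (1 : mfps R V) m = (m == mone)%:R.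
Proof. by rewrite /=; case: eqP. Qed.

Lemma mmul_inj (c : {cmonom V}) : injective (mmul c).
Proof.
move=> a b /eqP/cmP ab; apply/eqP/cmP => i.
by move: (ab i); rewrite !cmM => /addnI.
Qed.

Lemma mfps_coef_varM (v : V) f m : (mfps_var R v * f) (mmul (ucm v) m) = f m.
Proof.
have [D Du Dm] := cmonom_divisors (mmul (ucm v) m).
rewrite (mfps_coefM _ _ Du Dm) (bigD1_seq (ucm v)) //=; last exact: (Dm _ m).
rewrite [X in _ + X]big1 ?addr0 => [|a /negPf a1]; last first.
  by rewrite big1 // => b _; rewrite a1 mul0r.
rewrite (eq_bigl (pred1 m)) => [|b]; last by rewrite /= (inj_eq (@mmul_inj _)).
rewrite sum_seq_pred1 // ?eqxx ?mul1r //.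
by apply: (Dm _ (ucm v)); rewrite monalg.mulmC.
Qed.

Lemma mfps_coef_varM0 (v : V) f m : m v = 0%N -> (mfps_var R v * f) m = 0.
Proof.
move=> mv; have [D Du Dm] := cmonom_divisors m.
rewrite (mfps_coefM _ _ Du Dm) big1 // => a _; rewrite big1 // => b /eqP abm /=.
case: eqP => [av|]; last by rewrite mul0r.
by move: mv; rewrite -abm cmM av cmUU.
Qed.

(** From u f = v f, the coefficient of f at m is that of v f at u m. It is 0 if v does not divide m,
    and otherwise it is the coefficient of f at u m / v, where the exponent of v has dropped by
    one. *)
Lemma mfps_var_subM_eq0 (u v : V) f :
  u != v -> f * (mfps_var R u - mfps_var R v) = 0 -> f = 0.
Proof.
move=> uv fuv0.
have fuv : mfps_var R u * f = mfps_var R v * f.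
  by apply/eqP; rewrite -subr_eq0 -mulrBl mulrC fuv0.
have f_rec m : f m = (mfps_var R v * f) (mmul (ucm u) m).
  by rewrite -fuv mfps_coef_varM.
clear fuv fuv0.
have Xuv m : mmul (ucm u) m v = m v by rewrite cmM cmU (negPf uv).
apply: mfpsP => m; rewrite mfps_coef0; have [k] := ubnP (m v).
elim: k m => [//|k IHk] m mk.
have [mv|mv] := posnP (m v).
  by rewrite f_rec mfps_coef_varM0 ?Xuv.
pose m' := divcm m (ucm v).
have mE : m = mmul (ucm v) m'.
  apply/eqP/cmP => i; rewrite cmM divcmE ucmE.
  by case: eqP => [<-|]; rewrite ?subnKC ?subn0.
rewrite f_rec mE monalg.mulmA (monalg.mulmC (ucm u)) -monalg.mulmA.
rewrite mfps_coef_varM; apply: IHk; rewrite Xuv.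
by rewrite mE cmM cmUU in mk.
Qed.

(** * Filtration by total degree *)

Definition vanish_below (N : nat) f := forall m, (mdeg m < N)%N -> f m = 0.

Lemma vanish_below0 f : vanish_below 0 f. Proof. by []. Qed.

Lemma vanish_belowD N f g :
  vanish_below N f -> vanish_below N g -> vanish_below N (f + g).
Proof. by move=> f0 g0 m mN; rewrite mfps_coefD f0 ?g0 ?addr0. Qed.

Lemma vanish_belowN N f : vanish_below N f -> vanish_below N (- f).
Proof. by move=> f0 m mN; rewrite mfps_coefN f0 ?oppr0. Qed.

Lemma vanish_below_sum N (I : Type) (r : seq I) (P : pred I) (F : I -> mfps R V) :
  (forall i, P i -> vanish_below N (F i)) ->
  vanish_below N (\sum_(i <- r | P i) F i).
Proof. by move=> F0 m mN; rewrite mfps_coef_sum big1 // => i Pi; exact: F0. Qed.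

Lemma vanish_belowM N1 N2 f g :
  vanish_below N1 f -> vanish_below N2 g -> vanish_below (N1 + N2) (f * g).
Proof.
move=> f0 g0 m mN; have [D Du Dm] := cmonom_divisors m.
rewrite (mfps_coefM _ _ Du Dm) big1 // => a _; rewrite big1 // => b /eqP abm.
have [aN|aN] := ltnP (mdeg a) N1; first by rewrite f0 ?mul0r.
rewrite g0 ?mulr0 // -(ltn_add2l N1) (leq_ltn_trans _ mN) //.
by rewrite -abm mdegM leq_add2r.
Qed.

Lemma vanish_belowMl N f g : vanish_below N g -> vanish_below N (f * g).
Proof. by move=> g0; rewrite -[N]add0n; apply: vanish_belowM. Qed.

Lemma vanish_below_exp N f : vanish_below 1 f -> vanish_below N (f ^+ N).
Proof.
move=> f0; elim: N => [|N IHN]; first exact: vanish_below0.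
by rewrite exprS -add1n; apply: vanish_belowM.
Qed.

Lemma vanish_below_var v : vanish_below 1 (mfps_var R v).
Proof.
move=> m; rewrite ltnS leqn0 /= => /eqP m0.
by case: eqP => // mv; rewrite mv mdegU in m0.
Qed.

(** The filtration is separated, since every monomial has a finite degree; identities between
    infinite sums can thus be checked one order at a time. *)
Lemma eq_vanish_below f g : (forall N, vanish_below N (f - g)) -> f = g.
Proof.
move=> fg; apply: mfpsP => m; apply/subr0_eq.
exact: (fg (mdeg m).+1 m (ltnSn _)).
Qed.

End PowerSeries.

(** * Power series in one variable *)

Definition tcoef (R : comNzRingType) (P : mfps R unit) (k : nat) : R :=
  P (expcmn (ucm tt) k).
Arguments tcoef : simpl never.

Section OneVariable.
Variable (R : comNzRingType).
Implicit Types (P Q : mfps R unit).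

Lemma mdeg_unit (m : {cmonom unit}) : mdeg m = m tt.
Proof.
rewrite (@mdegEw _ m [fset tt]%fset) ?big_seq_fset1 //.
by apply/fsubsetP => -[]; rewrite inE.
Qed.

Lemma expcmn_tt k : expcmn (ucm tt) k tt = k.
Proof.
rewrite /expcmn (Monoid.iteropE (@mmul (cmonom unit))).
by elim: k => [|k IHk] /=; rewrite ?cm1 // cmM IHk cmUU.
Qed.

Lemma cmonom_unitE (m : {cmonom unit}) : m = expcmn (ucm tt) (mdeg m).
Proof. by apply/eqP/cmP => -[]; rewrite expcmn_tt mdeg_unit. Qed.

Lemma tcoefP P Q : (forall k, tcoef P k = tcoef Q k) -> P = Q.
Proof. by move=> PQ; apply: mfpsP => m; rewrite (cmonom_unitE m); apply: PQ. Qed.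

Lemma tcoefM P Q k :
  tcoef (P * Q) k = \sum_(i < k.+1) tcoef P i * tcoef Q (k - i).
Proof.
pose mon := expcmn (ucm tt).
have mon_inj : injective mon.
  by move=> i j /(congr1 (fun m : {cmonom unit} => m tt)); rewrite !expcmn_tt.
have monM i j : mmul (mon i) (mon j) = mon (i + j)%N.
  by apply/eqP/cmP => -[]; rewrite cmM !expcmn_tt.
rewrite /tcoef -/mon (@mfps_coefM _ _ [seq mon i | i <- iota 0 k.+1]); first last.
- move=> a b /(congr1 (fun m : {cmonom unit} => m tt)).
  rewrite cmM expcmn_tt => abk; rewrite (cmonom_unitE a) map_f // mem_iota.
  by rewrite mdeg_unit add0n ltnS -abk leq_addr.
- by rewrite map_inj_uniq ?iota_uniq.
rewrite big_map -[iota 0 k.+1]/(index_iota 0 k.+1) big_mkord.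
apply: eq_bigr => i _; rewrite big_map.
rewrite (eq_bigl (pred1 (k - i)%N)) => [|j]; last first.
  have ik : (i <= k)%N by rewrite -ltnS.
  by rewrite /= monM (inj_eq mon_inj) -(eqn_add2l i (j : nat)) subnKC.
by rewrite sum_seq_pred1 ?iota_uniq // mem_iota add0n ltnS leq_subr.
Qed.

Lemma tcoef1 k : tcoef (1 : mfps R unit) k = (k == 0%N)%:R.
Proof. by rewrite /tcoef mfps_coef1 -mdeg_eq0 mdeg_unit expcmn_tt. Qed.

Definition tlin (c : R) : mfps R unit := 1 - mfps_term c (ucm tt).

Lemma tcoef_lin c k : tcoef (tlin c) k = (k == 0%N)%:R - (if k == 1%N then c else 0).
Proof.
rewrite /tcoef mfps_coefD mfps_coefN -/(tcoef (1 : mfps R unit) k) tcoef1 /=.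
suff -> : (expcmn (ucm tt) k == ucm tt) = (k == 1%N) by [].
apply/eqP/eqP => [/(congr1 (fun m : {cmonom unit} => m tt))|->] //.
by rewrite expcmn_tt cmUU.
Qed.

Definition tgeom (c : R) : mfps R unit := MFPS (fun m => c ^+ mdeg m).

Lemma tcoef_geom c k : tcoef (tgeom c) k = c ^+ k.
Proof. by rewrite /tcoef /= mdeg_unit expcmn_tt. Qed.

Lemma tgeom_lin c : tgeom c * tlin c = 1.
Proof.
apply: tcoefP => k; rewrite tcoefM tcoef1 big_ord_recr /= subnn.
rewrite tcoef_geom tcoef_lin subr0 mulr1.
case: k => [|k]; first by rewrite big_ord0 add0r.
(* At t^(k+1) only the last two terms survive, c^(k+1) and - c^k c, and they cancel. *)
rewrite big_ord_recr /= subSnn tcoef_lin sub0r tcoef_geom mulrN exprSr.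
rewrite big1 ?add0r ?addNr // => i _.
rewrite subSn ?(ltnW (ltn_ord i)) // -(subnSK (ltn_ord i)).
by rewrite tcoef_lin subr0 mulr0.
Qed.

Lemma tlin_unit c : tlin c \is a GRing.unit.
Proof. by apply/unitrPr; exists (tgeom c); rewrite mulrC tgeom_lin. Qed.

Lemma tlinV c : (tlin c)^-1 = tgeom c.
Proof. by rewrite -[LHS]mul1r -(tgeom_lin c) mulrK ?tlin_unit. Qed.

End OneVariable.

(** * Substitution of a series without constant term *)

Section Evaluation.
Variables (R : comNzRingType) (V : choiceType).
Implicit Types (y : mfps R V) (P Q : mfps (mfps R V) unit).

(** In the applications h is a finite truncation of both sides, chosen for each N. *)
Lemma eq_approx (f g : mfps R V) :
  (forall N, exists2 h, vanish_below N (f - h) & vanish_below N (g - h)) ->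
  f = g.
Proof.
move=> fg; apply: eq_vanish_below => N; have [h fh gh] := fg N.
have -> : f - g = (f - h) + - (g - h) by rewrite opprB addrA subrK.
exact: vanish_belowD fh (vanish_belowN gh).
Qed.

Definition tpoly (N : nat) P : {poly mfps R V} := \poly_(i < N) tcoef P i.

(** The error is a multiple of 'X^N, which has order at least N once evaluated at a series without
    constant term. *)
Lemma tpolyM N P Q :
  tpoly N P * tpoly N Q =
  tpoly N (P * Q) + drop_poly N (tpoly N P * tpoly N Q) * 'X^N.
Proof.
rewrite -{1}[LHS](poly_take_drop N); congr (_ + _); apply/polyP => i.
rewrite coef_take_poly coef_poly; case: ltnP => // iN.
rewrite coefM tcoefM; apply: eq_bigr => -[j ji] _ /=.
by rewrite !coef_poly !(leq_ltn_trans _ iN) // leq_subr.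
Qed.

(* The value of P at t = y, for y without constant term: the powers
   y ^+ i with i > mdeg m do not reach the monomial m. *)
Definition teval y P : mfps R V := MFPS (fun m => (tpoly (mdeg m).+1 P).[y] m).

Lemma teval_approx N y P : vanish_below 1 y ->
  vanish_below N (teval y P - (tpoly N P).[y]).
Proof.
move=> y0 m mN; rewrite mfps_coefD mfps_coefN [X in X - _]/=.
apply/eqP; rewrite subr_eq0; apply/eqP.
rewrite !horner_poly !mfps_coef_sum.
rewrite -(big_mkord predT (fun i => (tcoef P i * y ^+ i) m)).
rewrite -(big_mkord predT (fun i => (tcoef P i * y ^+ i) m)).
(* The extra terms have mdeg m < i < N, and y ^+ i has order at least i. *)
rewrite (big_cat_nat (leq0n _) mN) [X in _ = _ + X]big_nat_cond.
rewrite [X in _ = _ + X]big1 ?addr0 // => i /andP[/andP[mi _] _].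
have := @vanish_belowMl _ _ i (tcoef P i) _ (vanish_below_exp y0).
by apply.
Qed.

Lemma tevalM y P Q : vanish_below 1 y ->
  teval y (P * Q) = teval y P * teval y Q.
Proof.
move=> y0; apply: eq_approx => N; exists ((tpoly N P).[y] * (tpoly N Q).[y]).
  rewrite -hornerM tpolyM hornerD opprD addrA; apply: vanish_belowD.
    exact: teval_approx.
  apply: vanish_belowN; rewrite hornerM hornerXn.
  exact: vanish_belowMl (vanish_below_exp y0).
have -> : teval y P * teval y Q - (tpoly N P).[y] * (tpoly N Q).[y] =
    teval y P * (teval y Q - (tpoly N Q).[y]) +
    (tpoly N Q).[y] * (teval y P - (tpoly N P).[y]).
  by rewrite !mulrBr !(mulrC (tpoly N Q).[y]) addrA subrK.
by apply: vanish_belowD; apply: vanish_belowMl; exact: teval_approx.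
Qed.

Lemma teval_lin y c : vanish_below 1 y -> teval y (tlin c) = 1 - c * y.
Proof.
move=> y0; apply: eq_approx => N.
(* From order 2 on the truncation of 1 - c t is exact; at order 1 only its constant term 1 remains,
   and at order 0 any h will do. *)
case: N => [|[|N]]; [by exists 0|exists 1|exists (1 - c * y)].
- have -> : (1 : mfps R V) = (tpoly 1 (tlin c)).[y].
    by rewrite horner_poly big_ord1 tcoef_lin subr0 mulr1.
  exact: teval_approx.
- rewrite addrAC subrr add0r; apply: vanish_belowN; exact: vanish_belowMl.
- have -> : 1 - c * y = (tpoly N.+2 (tlin c)).[y].
    rewrite horner_poly !big_ord_recl big1 => [|i _].
      by rewrite !tcoef_lin /= subr0 sub0r expr0 mulr1 expr1 mulNr addr0.
    by rewrite tcoef_lin subr0 mul0r.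
  exact: teval_approx.
- by rewrite subrr.
Qed.

Lemma teval1 y : vanish_below 1 y -> teval y 1 = 1.
Proof.
move=> y0; have := teval_lin 0 y0; rewrite mul0r subr0 => <-; congr teval.
by apply: tcoefP => k; rewrite tcoef_lin tcoef1 if_same subr0.
Qed.

Lemma teval_prod y (I : Type) (r : seq I) (F : I -> mfps (mfps R V) unit) :
  vanish_below 1 y ->
  teval y (\prod_(i <- r) F i) = \prod_(i <- r) teval y (F i).
Proof.
move=> y0; apply: (big_morph (teval y)); last exact: teval1.
by move=> P Q; exact: tevalM.
Qed.

(** For h_k this is the half of homogeneity that allows the sum of the h_(m+b)[Y] h_b[W] to be cut
    at b < N modulo order N. *)
Definition graded P := forall k, vanish_below k (tcoef P k).

Lemma gradedM P Q : graded P -> graded Q -> graded (P * Q).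
Proof.
move=> grP grQ k; rewrite tcoefM; apply: vanish_below_sum => -[i ik] _ /=.
have := vanish_belowM (grP i) (grQ (k - i)%N).
by rewrite subnKC // -ltnS.
Qed.

Lemma graded1 : graded 1.
Proof. by move=> [|k] m; rewrite tcoef1. Qed.

Lemma graded_exp P k : graded P -> graded (P ^+ k).
Proof.
move=> grP; elim: k => [|k IHk]; first exact: graded1.
by rewrite exprS; exact: gradedM.
Qed.

Lemma graded_lin c : vanish_below 1 c -> graded (tlin c).
Proof.
move=> c0 [|[|k]]; rewrite tcoef_lin; first exact: vanish_below0.
  by rewrite sub0r; exact: vanish_belowN.
by rewrite subrr.
Qed.

Lemma graded_geom c : vanish_below 1 c -> graded (tgeom c).
Proof. by move=> c0 k; rewrite tcoef_geom; exact: vanish_below_exp. Qed.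

End Evaluation.

(** * Plethystic generating series *)

Section Plethysm.
Implicit Types (Z Y W : alphabet) (u : var).

Local Notation lin u := (tlin (mfps_var int u)).

(** Letters outside the support have exponent 0. A larger index set D lets products for different
    alphabets be compared factor by factor. *)
Lemma pleth_hgenE (D : {fset var}) Z : (msupp Z `<=` D)%fset ->
  pleth_hgen Z = \prod_(u <- D) lin u ^ (- Z@_u).
Proof.
move=> ZD; rewrite /pleth_hgen; apply: big_fset_incl ZD _ => u _ uZ.
by rewrite mcoeff_outdom // oppr0 expr0z.
Qed.

Lemma pleth_hgenD Z W : pleth_hgen (Z + W) = pleth_hgen Z * pleth_hgen W.
Proof.
rewrite (@pleth_hgenE (msupp Z `|` msupp W)%fset (Z + W)) ?msuppD_le //.
rewrite (@pleth_hgenE (msupp Z `|` msupp W)%fset Z) ?fsubsetUl //.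
rewrite (@pleth_hgenE (msupp Z `|` msupp W)%fset W) ?fsubsetUr //.
rewrite -big_split /=; apply: eq_bigr => u _.
by rewrite mcoeffD opprD exprzDr ?tlin_unit.
Qed.

Lemma pleth_hgen0 : pleth_hgen 0 = 1.
Proof. by rewrite /pleth_hgen msupp0 big_seq_fset0. Qed.

Lemma pleth_hgenNK Z : pleth_hgen Z * pleth_hgen (- Z) = 1.
Proof. by rewrite -pleth_hgenD subrr pleth_hgen0. Qed.

Lemma pleth_hgenNU u : pleth_hgen (- << u >>) = lin u.
Proof.
rewrite (@pleth_hgenE [fset u]%fset) ?msuppN ?msuppU_le //.
by rewrite big_seq_fset1 mcoeffN mcoeffUU opprK expr1z.
Qed.

Lemma pleth_hgenU u : pleth_hgen << u >> = tgeom (mfps_var int u).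
Proof.
rewrite (@pleth_hgenE [fset u]%fset) ?msuppU_le //.
by rewrite big_seq_fset1 mcoeffUU exprN1 tlinV.
Qed.

Lemma pleth_hgenN_sum (I : Type) (r : seq I) (f : I -> var) :
  pleth_hgen (- \sum_(i <- r) << f i >>) = \prod_(i <- r) lin (f i).
Proof.
rewrite -sumrN (big_morph _ pleth_hgenD pleth_hgen0).
by apply: eq_bigr => i _; exact: pleth_hgenNU.
Qed.

Lemma pleth_hE (k : nat) Z : pleth_h k%:Z Z = tcoef (pleth_hgen Z) k.
Proof. by []. Qed.

Lemma pleth_h_neg (m : int) Z : (m < 0)%R -> pleth_h m Z = 0.
Proof. by case: m. Qed.

Lemma pleth_hU (k : nat) u : pleth_h k%:Z << u >> = mfps_var int u ^+ k.
Proof. by rewrite pleth_hE pleth_hgenU tcoef_geom. Qed.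

Lemma graded_pleth_hgen Z : graded (pleth_hgen Z).
Proof.
rewrite (@pleth_hgenE (msupp Z)) ?fsubset_refl //.
elim/big_rec: _ => [|u P _]; first exact: graded1.
(* A nonnegative exponent gives a power of 1 - u t, a negative one a power of the geometric
   series. *)
apply: gradedM; case: (- Z@_u) => k.
  by rewrite -exprnP; apply: graded_exp; apply: graded_lin; exact: vanish_below_var.
rewrite NegzE -exprnN -exprVn tlinV.
by apply: graded_exp; apply: graded_geom; exact: vanish_below_var.
Qed.

(** The generating series is a product of [size r] factors 1 - u t, hence a polynomial in t of
    degree at most [size r]. *)
Lemma pleth_hN_sum_eq0 (I : Type) (r : seq I) (f : I -> var) (k : nat) :
  (size r < k)%N -> pleth_h k%:Z (- \sum_(i <- r) << f i >>) = 0.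
Proof.
rewrite pleth_hE pleth_hgenN_sum.
elim: r k => [|i r IHr] k rk.
  by rewrite big_nil tcoef1; case: k rk.
rewrite big_cons tcoefM big1 // => -[j jk] _ /=.
case: j jk => [|[|j]] jk; first by rewrite subn0 (IHr k) ?mulr0 // ltnW.
  by rewrite IHr ?mulr0 //; case: k rk {jk} => // k; rewrite subn1.
by rewrite tcoef_lin subrr mul0r.
Qed.

(** This is the Cauchy product at t^k, summed over l < n instead of l <= k so as to match a row of
    an n by n matrix. *)
Lemma pleth_h_conv n (k : nat) Z Y :
  (forall l : nat, (n <= l)%N -> pleth_h l%:Z Z = 0) ->
  \sum_(l < n) pleth_h l%:Z Z * pleth_h (k%:Z - l%:Z) Y = pleth_h k%:Z (Z + Y).
Proof.
move=> Z0; rewrite pleth_hE pleth_hgenD tcoefM.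
pose F l := pleth_h l%:Z Z * pleth_h (k%:Z - l%:Z) Y.
transitivity (\sum_(l < k.+1) F l); last first.
  apply: eq_bigr => l _; rewrite /F pleth_hE; congr (_ * _).
  by rewrite subzn ?pleth_hE // -ltnS.
rewrite -(big_mkord predT F) -(big_mkord predT F).
have widen p q : (p <= q)%N -> (forall l, (p <= l)%N -> F l = 0) ->
    \sum_(0 <= l < q) F l = \sum_(0 <= l < p) F l.
  move=> pq F0; rewrite (big_cat_nat (leq0n _) pq) /=.
  rewrite [X in _ + X]big_nat_cond [X in _ + X]big1 ?addr0 //.
  by move=> l /andP[/andP[/F0]].
(* Both sums are extended to n + k + 1 terms: those with l >= n vanish by hypothesis, those with l >
   k because k - l is negative. *)
rewrite -(widen n (n + k.+1)%N) ?leq_addr //; last first.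
  by move=> l nl; rewrite /F Z0 ?mul0r.
rewrite (widen k.+1) ?leq_addl // => l kl.
by rewrite /F (pleth_h_neg (m := _ - _)) ?mulr0 // subr_lt0 ltz_nat.
Qed.

(** The pairs with a - b = z are the (z + b, b), and h_b[W] has order at least b, so those with b >=
    N do not reach degrees below N. *)
Lemma pleth_h_ominus_approx N (z : int) Y W :
  vanish_below N (pleth_h_ominus z Y W -
    \sum_(b < N) pleth_h (z + b%:Z) Y * pleth_h b%:Z W).
Proof.
move=> mu muN; rewrite mfps_coefD mfps_coefN mfps_coef_sum.
rewrite -[pleth_h_ominus z Y W mu]/(\sum_(p \in [set p : nat * nat |
  (p.1%:Z - p.2%:Z)%R = z]%classic) (pleth_h p.1%:Z Y * pleth_h p.2%:Z W) mu).
apply/eqP; rewrite subr_eq0; apply/eqP.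
(* The finitely many pairs that can contribute at [mu]; when z + b < 0 there is no pair, and the
   matching h_(z+b)[Y] is 0. *)
pose r := [seq (absz (z + b%:Z), b) | b <- iota 0 N & (0 <= z + b%:Z)%R].
rewrite (@fsbigE _ _ _ _ _ r); first last.
- move=> [a b] /= abz abr.
  have [bN|bN] := ltnP b N; last first.
    have := @vanish_belowMl _ _ b (pleth_h a%:Z Y) _ (@graded_pleth_hgen W b).
    by apply; exact: leq_trans bN.
  case/negP: abr; apply/mapP; exists b; rewrite ?mem_filter ?mem_iota ?bN.
    by rewrite -abz subrK.
  by rewrite -abz subrK.
- move=> [a b] /= /mapP[c]; rewrite mem_filter => /andP[zc _] [-> ->].
  by rewrite gez0_abs // addrK.
- by rewrite map_inj_uniq ?filter_uniq ?iota_uniq // => ? ? [].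
rewrite /r big_map big_filter_cond.
rewrite -(big_mkord predT (fun b => (pleth_h (z + b%:Z) Y * pleth_h b%:Z W) mu)).
rewrite /index_iota subn0 big_mkcond; apply: eq_bigr => b _.
case: ifPn => [/andP[zb _]|]; first by rewrite gez0_abs.
rewrite negb_and -ltNge => /orP[/pleth_h_neg ->|]; first by rewrite mul0r.
have [zb|/pleth_h_neg ->] := leP 0 (z + b%:Z); last by rewrite mul0r.
by rewrite notin_setE /= gez0_abs // addrK.
Qed.

End Plethysm.

(** * Determinants *)

(** Quotients by a regular b are unique, so the one chosen by [xget] is a. *)
Lemma exact_div_mulK (R : comNzRingType) (V : choiceType) (a b : mfps R V) :
  GRing.rreg b -> exact_div (a * b) b = a.
Proof.
move=> b_reg; apply: b_reg; rewrite /exact_div.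
by apply: (@xgetPex _ 0 [set q | q * b = a * b]%classic); exists a.
Qed.

Lemma vandermonde_rreg n : GRing.rreg (vandermonde n).
Proof.
rewrite /vandermonde big_nat_cond.
apply: (big_rec (@GRing.rreg series)) => [|i a _ a_reg]; first exact: rreg1.
apply: rregM a_reg; rewrite big_nat_cond.
apply: (big_rec (@GRing.rreg series)) => [|j b /andP[/andP[ij _] _] b_reg].
  exact: rreg1.
apply: rregM b_reg; apply: mulIr0_rreg => f; apply: mfps_var_subM_eq0.
by apply/eqP => -[ij']; rewrite ij' ltnn in ij.
Qed.

Lemma det_vandermonde n :
  det_from1 n (fun i j => x_ j ^+ (n - i)) = vandermonde n.
Proof.
(* In [Vandermonde] the exponents increase down the rows. Rows and columns are both reversed, so the
   two signs cancel; listing the variables backwards in [a] compensates the reversal of the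
   columns. *)
pose a : 'rV[series]_n := \row_j x_ (rev_ord j).+1.
pose s := perm (@rev_ord_inj n).
have -> : det_from1 n (fun i j => x_ j ^+ (n - i)) =
    \det (row_perm s (col_perm s (Vandermonde n a))).
  by congr (\det _); apply/matrixP => i j; rewrite !mxE !permE rev_ordK.
rewrite row_permE col_permE !det_mulmx !det_perm odd_permV.
rewrite mulrCA -signr_addb addbb mulr1.
rewrite det_Vandermonde (reindex_inj rev_ord_inj) /=.
transitivity (\prod_(i < n) \prod_(j < n | (j < i)%N) (x_ j.+1 - x_ i.+1)).
  apply: eq_bigr => i _; rewrite (reindex_inj rev_ord_inj) /=.
  apply: eq_big => [j|j _]; first by have := ltn_ord i; have := ltn_ord j; lia.
  by rewrite !mxE !rev_ordK.
rewrite (exchange_big_dep predT) //= /vandermonde big_add1 big_mkord.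
by apply: eq_bigr => i _; rewrite big_add1 /= big_geq_mkord.
Qed.

Lemma alphX_sub_h_eq0 n j (l : nat) : (1 <= j <= n)%N -> (n <= l)%N ->
  pleth_h l%:Z (<< xv j >> - alphX n) = 0.
Proof.
move=> jn nl; have jr : j \in index_iota 1 n.+1 by rewrite mem_index_iota.
(* Cancelling x_j leaves minus a sum of n - 1 variables. *)
rewrite /alphX (big_rem j) //= opprD addNKr.
apply: pleth_hN_sum_eq0; rewrite size_rem // size_iota subn1 /=.
by apply: leq_trans nl; case: n jn {jr} => // /andP[]; case: j.
Qed.

(** The series of - X_n is an explicit product with constant term 1, and that of X_n is its
    inverse. *)
Lemma pleth_h0_alphX n : pleth_h 0 (alphX n) = 1.
Proof.
have tcoef0M (P Q : mfps series unit) : tcoef (P * Q) 0 = tcoef P 0 * tcoef Q 0.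
  by rewrite tcoefM big_ord1.
have NX1 : tcoef (pleth_hgen (- alphX n)) 0 = 1.
  rewrite pleth_hgenN_sum.
  rewrite (big_morph (fun P => tcoef P 0) tcoef0M (tcoef1 series 0)) big1 // => i _.
  by rewrite tcoef_lin subr0.
have := congr1 (fun P => tcoef P 0) (pleth_hgenNK (alphX n)).
by rewrite tcoef0M NX1 mulr1 tcoef1.
Qed.

Lemma det_from1_vandermonde n (F M : nat -> nat -> series) :
  (forall i j, (1 <= i <= n)%N -> (1 <= j <= n)%N ->
    \sum_(l < n) pleth_h l%:Z (<< xv j >> - alphX n) * M i (n - l)%N = F i j) ->
  det_from1 n F = det_from1 n M * vandermonde n.
Proof.
(* The entry (k, j), counted from 1, is (-1)^(n-k) e_(n-k)[X_n - x_j]. *)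
pose E := \matrix_(k < n, j < n)
  pleth_h (n - k.+1)%N%:Z (<< xv j.+1 >> - alphX n).
(* The factorization serves twice with the same E: for the given pair, and for x_j^(n-i) with
   h_(j-i)[X_n], which yields det E. *)
have detE (F' M' : nat -> nat -> series) :
  (forall i j, (1 <= i <= n)%N -> (1 <= j <= n)%N ->
    \sum_(l < n) pleth_h l%:Z (<< xv j >> - alphX n) * M' i (n - l)%N = F' i j) ->
  det_from1 n F' = det_from1 n M' * \det E.
  move=> FM; rewrite /det_from1 -det_mulmx; congr (\det _).
  apply/matrixP => i j; rewrite mxE [RHS]mxE -(FM i.+1 j.+1) ?ltn_ord //.
  rewrite (reindex_inj rev_ord_inj) /=; apply: eq_bigr => k _.
  by rewrite !mxE mulrC; congr (M' _ _ * _); rewrite subKn.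
move=> FM; rewrite (detE _ _ FM); congr (_ * _).
rewrite -det_vandermonde.
rewrite (detE _ (fun i j => pleth_h (j%:Z - i%:Z) (alphX n))) => [|i j iin jn].
  (* The matrix of the h_(j-i)[X_n] is upper unitriangular; it is transposed because [det_trig] is
     about lower triangular matrices. *)
  rewrite [det_from1 _ _](_ : _ = 1) ?mul1r // /det_from1 -det_tr det_trig.
    by rewrite big1 // => i _; rewrite !mxE subrr pleth_h0_alphX.
  apply/is_trig_mxP => i j ij; rewrite !mxE pleth_h_neg //.
  by rewrite subr_lt0 ltz_nat.
have Z0 l := @alphX_sub_h_eq0 n j l jn.
have -> : x_ j ^+ (n - i) =
    pleth_h (n - i)%N%:Z (<< xv j >> - alphX n + alphX n).
  by rewrite subrK -pleth_hU.
rewrite -(pleth_h_conv _ _ Z0); apply: eq_bigr => l _.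
have -> : (n - l)%N%:Z - i%:Z = (n - i)%N%:Z - l%:Z.
  by have := ltn_ord l; lia.
by [].
Qed.

Lemma exact_div_det_from1 n (F M : nat -> nat -> series) :
  (forall i j, (1 <= i <= n)%N -> (1 <= j <= n)%N ->
    \sum_(l < n) pleth_h l%:Z (<< xv j >> - alphX n) * M i (n - l)%N = F i j) ->
  exact_div (det_from1 n F) (vandermonde n) = det_from1 n M.
Proof.
move=> FM; rewrite (det_from1_vandermonde FM).
exact: exact_div_mulK (@vandermonde_rreg n).
Qed.

(** * Row identities for the numerators of G *)

Lemma pleth_h_ominus_conv n (m : nat) u Z Y W :
  (forall l : nat, (n <= l)%N -> pleth_h l%:Z Z = 0) -> Z + Y = << u >> ->
  \sum_(l < n) pleth_h l%:Z Z * pleth_h_ominus (m%:Z - l%:Z) Y W =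
  mfps_var int u ^+ m * teval (mfps_var int u) (pleth_hgen W).
Proof.
move=> Z0 ZY; set x := mfps_var int u; apply: eq_approx => N.
(* Both sides are compared with x^m times the sum of h_b[W] x^b over b < N. *)
exists (x ^+ m * (tpoly N (pleth_hgen W)).[x]); last first.
  rewrite -mulrBr; apply: vanish_belowMl; apply: teval_approx.
  exact: vanish_below_var.
have -> : x ^+ m * (tpoly N (pleth_hgen W)).[x] =
    \sum_(l < n) pleth_h l%:Z Z *
      \sum_(b < N) pleth_h (m%:Z - l%:Z + b%:Z) Y * pleth_h b%:Z W.
  transitivity (\sum_(b < N) \sum_(l < n)
      pleth_h l%:Z Z * (pleth_h (m%:Z - l%:Z + b%:Z) Y * pleth_h b%:Z W)).
    rewrite horner_poly mulr_sumr; apply: eq_bigr => b _.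
    (* For fixed b, the convolution over l collapses to h_(m+b)[Z + Y] = x^(m+b). *)
    rewrite mulrCA -exprD -pleth_hU -ZY -(pleth_h_conv _ _ Z0) mulrC mulr_suml.
    by apply: eq_bigr => l _; rewrite PoszD addrAC [RHS]mulrA.
  by rewrite exchange_big; apply: eq_bigr => l _; rewrite mulr_sumr.
rewrite -sumrB; apply: vanish_below_sum => l _; rewrite -mulrBr.
by apply: vanish_belowMl; exact: pleth_h_ominus_approx.
Qed.

Lemma teval_pleth_hgen (y : series) p q : vanish_below 1 y ->
  teval y (pleth_hgen (alphA p%:Z - alphB q%:Z)) =
  (\prod_(1 <= k < q.+1) (1 - beta k * y)) /
  (\prod_(1 <= k < p.+1) (1 - alpha k * y)).
Proof.
move=> y0.
have tevalN (I : Type) (r : seq I) (f : I -> var) :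
    teval y (pleth_hgen (- \sum_(i <- r) << f i >>)) =
    \prod_(i <- r) (1 - mfps_var int (f i) * y).
  rewrite pleth_hgenN_sum teval_prod //.
  by apply: eq_bigr => i _; exact: teval_lin.
(* The part in alpha has negative exponents; its value is found as the inverse of the value for -
   A_p, a finite product. *)
have NAK := congr1 (teval y) (pleth_hgenNK (alphA p%:Z)).
rewrite tevalM // teval1 // tevalN in NAK.
rewrite pleth_hgenD tevalM // tevalN mulrC; congr (_ * _).
set den := \prod_(1 <= _ < p.+1) _ in NAK *.
have den_unit : den \is a GRing.unit.
  by apply/unitrPr; exists (teval y (pleth_hgen (alphA p%:Z))); rewrite mulrC.
by rewrite -[RHS]mul1r -NAK mulrK.
Qed.

Theorem theorem3p4 (n : nat) (lam : seq nat)
    (n_ge1 : (1 <= n)%N) (lam_part : sorted geq lam)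
    (lam_size : (size lam <= n)%N) :
  grothG n lam =
    det_from1 n (fun i j =>
      pleth_h_ominus ((part lam i)%:Z - i%:Z + j%:Z)
        (alphX n) (alphA (part lam i)%:Z - alphB (i%:Z - 1)))
  /\
  grothg n lam =
    det_from1 n (fun i j =>
      pleth_h ((part lam i)%:Z - i%:Z + j%:Z)
        (alphX n - alphA ((part lam i)%:Z - 1) + alphB (i%:Z - 1))).
Proof.
split.
- apply: exact_div_det_from1 => i j iin jn.
  (* With row i + 1, the product over 1 <= k < i + 1 is the one attached to B_i. *)
  case: i iin => [//|i] iin.
  rewrite -mulrA -teval_pleth_hgen; last exact: vanish_below_var.
  have -> : i.+1%:Z - 1 = i%:Z by lia.
  have Z0 l := @alphX_sub_h_eq0 n j l jn.
  rewrite -(pleth_h_ominus_conv _ _ Z0 (subrK _ _)).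
  apply: eq_bigr => l _.
  (* Column n - l carries the index m - l with m = lambda_i + n - i; the truncated subtractions are
     exact because the row index is at most n and l < n. *)
  have -> // : (part lam i.+1)%:Z - i.+1%:Z + (n - l)%N%:Z =
               (part lam i.+1 + n - i.+1)%N%:Z - l%:Z.
  by have := ltn_ord l; lia.
- apply: exact_div_det_from1 => i j iin jn.
  set C := alphA _; set D := alphB _.
  (* Inserting - X_n + X_n splits off the alphabet of E from that of the Jacobi-Trudi row. *)
  have -> : << xv j >> - C + D = (<< xv j >> - alphX n) + (alphX n - C + D).
    by rewrite !addrA subrK.
  have -> : (part lam i)%:Z + n%:Z - i%:Z = (part lam i + n - i)%N%:Z by lia.
  have Z0 l := @alphX_sub_h_eq0 n j l jn.
  rewrite -(pleth_h_conv _ _ Z0); apply: eq_bigr => l _.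
  have -> // : (part lam i)%:Z - i%:Z + (n - l)%N%:Z =
               (part lam i + n - i)%N%:Z - l%:Z.
  by have := ltn_ord l; lia.
Qed.
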